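(* Let $0<\alpha<1/2$ and $\beta>0$, and let $f$ be the density of the power Lindley distribution $PL(\alpha,\beta)$. The following functions are perturbation functions of the density $f$: (i) $\displaystyle H_1(x)=M_1\frac{x^{1-\alpha}}{1+x^\alpha}\exp(-\beta x^\alpha)\sin\left[2\beta x^\alpha\tan(\pi\alpha)\right]$; (ii) $\displaystyle H_2(x)=M_2\frac{x^{1-\alpha}}{1+x^\alpha}\exp(\beta x^\alpha-bx^\gamma)\sin\left[bx^\gamma\tan(\pi\gamma)\right]$, where $b>0$ and $\gamma\in(\alpha,1/2)$; (iii) $\displaystyle H_3(x)=M_3\frac{\sin[\beta x^\alpha\tan(\pi\alpha)-\pi\alpha]+x^\alpha\sin[\beta x^\alpha\tan(\pi\alpha)-2\pi\alpha]}{1+x^\alpha}$. Here the formulas are for $x\ge 0$, $H_i(x)=0$ for $x<0$, and the constants $M_i$ are chosen in such a way that $\sup_{x\in\mathbb{R}}|H_i(x)|=1$, $i=1,2,3$.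
   Context: For $\alpha,\beta>0$, the power Lindley distribution $PL(\alpha,\beta)$ is the probability distribution with density $f(x)=\frac{\alpha\beta^2}{\beta+1}\left(1+x^\alpha\right)x^{\alpha-1}e^{-\beta x^\alpha}$ for $x>0$ (and $f(x)=0$ for $x\le 0$). All its moments are finite. Perturbation function: let $f$ be the probability density function of a random variable with finite moments of all orders, and let $h$ be an integrable function on $(-\infty,\infty)$ such that $\sup_{x\in\mathbb{R}}|h(x)|=1$. If $\int_{\mathbb{R}}x^k h(x)f(x)\,dx=0$ for all $k\in\mathbb{N}_0=\{0,1,2,\dots\}$, then $h$ is called a perturbation function of the density $f$.
   Formalization: In (iii), H_3 oscillates without decay at infinity, so it is never integrable on (-∞,∞) as the definition of perturbation function demands; for H_3 ''integrable'' is replaced by ''locally integrable'', and every other clause is kept. *)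

(* Defs.v *)
From HB Require Import structures.
From mathcomp Require Import all_boot all_order all_algebra.
From mathcomp Require Import all_classical all_reals all_analysis.

Set Implicit Arguments.
Unset Strict Implicit.
Unset Printing Implicit Defensive.

Import Order.TTheory GRing.Theory Num.Theory.
Import numFieldNormedType.Exports.

Local Open Scope classical_set_scope.
Local Open Scope ring_scope.

Definition density (R : realType) (f : R -> R) : Prop :=
  [/\ measurable_fun setT f,
      forall x, 0 <= f x &
      (\int[lebesgue_measure]_x (f x)%:E = 1)%E].

Definition finite_moments (R : realType) (f : R -> R) : Prop :=
  forall k : nat,
    (@lebesgue_measure R).-integrable setT (fun x => (x ^+ k * f x)%:E).

(* The genuine supremum over all real numbers, not an essential one; it is
   taken in the extended reals, so that it is +oo for an unbounded [h]. *)
Definition sup_abs (R : realType) (h : R -> R) : \bar R :=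
  ereal_sup [set `|h x|%:E | x in [set: R]].

(* [integ h] says in which sense [h] is integrable on the real line.
   The Lebesgue integral below is never a default value: [x ^+ k * f x] is
   integrable, and [h] is bounded by 1 (and measurable, for both instances of
   [integ] that follow). *)
Definition perturbation_function_for (R : realType)
    (integ : (R -> R) -> Prop) (f h : R -> R) : Prop :=
  [/\ density f /\ finite_moments f,
      integ h,
      sup_abs h = 1%E &
      forall k : nat,
        (\int[lebesgue_measure]_x (x ^+ k * h x * f x)%:E = 0)%E].

Definition perturbation_function (R : realType) (f h : R -> R) : Prop :=
  perturbation_function_for
    (fun g => (@lebesgue_measure R).-integrable setT (EFin \o g)) f h.

(* The same notion for functions that are only integrable on every compact
   set. It is needed because [H3] oscillates without decaying at infinity, so
   that it is not Lebesgue integrable on the whole line. *)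
Definition perturbation_function_loc (R : realType) (f h : R -> R) : Prop :=
  perturbation_function_for (locally_integrable setT) f h.

Definition power_lindley_pdf (R : realType) (alpha beta x : R) : R :=
  if 0 < x then
    alpha * beta ^+ 2 / (beta + 1) * (1 + x `^ alpha) * x `^ (alpha - 1)
      * expR (- (beta * x `^ alpha))
  else 0.

Definition H1 (R : realType) (alpha beta M x : R) : R :=
  if 0 <= x then
    M * (x `^ (1 - alpha) / (1 + x `^ alpha))
      * expR (- (beta * x `^ alpha))
      * sin (2 * beta * x `^ alpha * tan (pi * alpha))
  else 0.

Definition H2 (R : realType) (alpha beta b gamma M x : R) : R :=
  if 0 <= x then
    M * (x `^ (1 - alpha) / (1 + x `^ alpha))
      * expR (beta * x `^ alpha - b * x `^ gamma)
      * sin (b * x `^ gamma * tan (pi * gamma))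
  else 0.

Definition H3 (R : realType) (alpha beta M x : R) : R :=
  if 0 <= x then
    M * ((sin (beta * x `^ alpha * tan (pi * alpha) - pi * alpha)
          + x `^ alpha
            * sin (beta * x `^ alpha * tan (pi * alpha) - 2 * pi * alpha))
         / (1 + x `^ alpha))
  else 0.

(* Main.v *)
(** On x > 0 each product x^k H_i(x) f(x) is a combination of functions
    x^(q-1) exp(-b x^a) sin(b x^a tan t - phi) with sin(q t/a - phi) = 0.
    With b = c cos t, such a function belongs to the family
      g_t(x) = x^(q-1) exp(-c x^a cos t) sin(c x^a sin t - (q/a) t + psi),
    where sin psi = 0.  The integral of g_t over x > 0 does not depend on t in
    [0, pi/2[, because dg_t/dt is the x-derivative of
      -(1/a) x^q exp(-c x^a cos t) cos(c x^a sin t - (q/a) t + psi),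
    which vanishes at 0 and at infinity; at t = 0 it is a multiple of
    sin psi = 0.  H1 is the instance gamma = alpha, b = 2 beta of H2. *)
Require Import Defs.
From HB Require Import structures.
From mathcomp Require Import all_boot all_order all_algebra.
From mathcomp Require Import all_classical all_reals all_analysis.
From mathcomp Require Import measurable_realfun ring lra.

Set Implicit Arguments.
Unset Strict Implicit.
Unset Printing Implicit Defensive.

Import Order.TTheory GRing.Theory Num.Theory.
Import numFieldNormedType.Exports.

Local Open Scope classical_set_scope.
Local Open Scope ring_scope.

(** * The fundamental theorem of calculus on the open half-line *)

Lemma itv0y_bigcup_segments (R : realType) :
  \bigcup_n `[n.+1%:R^-1, n.+2%:R]%classic = `]0, +oo[%classic :> set R.
Proof.
apply/seteqP; split => [x [n _] /=|x /=]; rewrite !in_itv/= ?andbT.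
  by case/andP => + _; apply: lt_le_trans; rewrite invr_gt0 ltr0n.
move=> x0; have xV0 : 0 < x^-1 by rewrite invr_gt0.
exists (maxn (Num.trunc x) (Num.trunc x^-1)) => //=; rewrite in_itv/=.
apply/andP; split.
- rewrite invf_ple ?posrE ?ltr0n//.
  by rewrite ltW// (lt_le_trans (truncnS_gt _))// ler_nat ltnS leq_maxr.
- by rewrite ltW// (lt_le_trans (truncnS_gt _))// ler_nat ltnS leqW// leq_maxl.
Qed.

Section FTC_itv0y.
Context (R : realType).
Local Notation mu := (@lebesgue_measure R).
Variables (f F : R -> R) (l0 loo : R).
Hypothesis dF : forall x : R, 0 < x -> is_derive x 1 F (f x).
Hypothesis cf : forall x : R, 0 < x -> {for x, continuous f}.
Hypothesis F0 : F x @[x --> 0^'+] --> l0.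
Hypothesis Foo : F x @[x --> +oo] --> loo.

(** Increasing segments exhausting the half-line. The shift from [n.+1] to [n.+2] makes them
    nondegenerate already at [n = 0], where the segment is [[1, 2]]. *)
Let I (n : nat) : set R := `[n.+1%:R^-1, n.+2%:R]%classic.

Let I_gt0 n x : I n x -> 0 < x.
Proof.
move=> Ix; suff : `]0, +oo[%classic x by rewrite /= in_itv/= andbT.
by rewrite -itv0y_bigcup_segments; exists n.
Qed.

Let subI m n : (m <= n)%N -> I m `<=` I n.
Proof.
move=> mn; apply: subset_itv; rewrite bnd_simp.
- by rewrite lef_pV2 ?posrE// ler_nat.
- by rewrite ler_nat.
Qed.

(** On each segment the classical theorem applies, as the endpoints are positive. These endpoints
    tend to [+oo] and to [0] from the right, which brings in the two limits of [F]. *)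
Let integral_segments :
  (\int[mu]_(x in I n) (f x)%:E)%E @[n --> \oo] --> (loo - l0)%:E.
Proof.
have -> : (fun n => \int[mu]_(x in I n) (f x)%:E)%E =
    (fun n => (F n.+2%:R - F n.+1%:R^-1)%:E).
  apply/funext => n; have lt_n : n.+1%:R^-1 < n.+2%:R :> R.
    by rewrite (@le_lt_trans _ _ 1) ?ltr1n// invf_le1 ?ler1n ?ltr0n.
  have cF (x : R) : 0 < x -> {for x, continuous F}.
    by move=> x0; apply/differentiable_continuous/derivable1_diffP; case: (dF x0).
  have [I1 I2] : I n n.+1%:R^-1 /\ I n n.+2%:R.
    by rewrite /I/= !in_itv/= !lexx ltW.
  rewrite (@continuous_FTC2 _ _ F)//.
  - by apply: continuous_in_subspaceT => x /set_mem/I_gt0/cf.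
  - split.
    + by move=> x /subset_itv_oo_cc/I_gt0/dF[].
    + by apply/cvg_at_right_filter/cF; exact: I_gt0 I1.
    + by apply/cvg_at_left_filter/cF; exact: I_gt0 I2.
  - by move=> x /subset_itv_oo_cc/I_gt0/dF; rewrite derive1E => -[_ ->].
apply: cvg_EFin; first exact: nearW.
apply: cvgB.
- apply: (proj1 (cvg_pinftyP _ _) Foo).
  rewrite (_ : (fun n => n.+2%:R) = (fun n => (n + 2)%:R)); last first.
    by apply/funext => n; rewrite addn2.
  by rewrite (@cvg_shiftn 2 _ (fun n => n%:R : R)); exact: cvgr_idn.
- apply: (proj1 (cvg_at_rightP _ _ _) F0); split; last exact: cvg_harmonic.
  by move=> n; rewrite invr_gt0.
Qed.

Let mf : measurable_fun (`]0, +oo[ : set R) f.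
Proof.
apply: open_continuous_measurable_fun => // x.
by rewrite inE/= in_itv/= andbT => /cf.
Qed.

(** Monotone convergence along the segments. Since [f] is nonnegative, integrability comes out as a
    consequence of the finite value instead of being assumed. *)
Lemma ge0_FTC_itv0y : (forall x, 0 < x -> 0 <= f x) ->
  (\int[mu]_(x in `]0%R, +oo[) (f x)%:E = (loo - l0)%:E)%E.
Proof.
move=> f0; rewrite -itv0y_bigcup_segments; apply: (cvg_unique _ _ integral_segments) => //.
apply: (@ge0_nondecreasing_set_cvg_integral _ (measurableTypeR R)).
- by move=> m n mn; rewrite subsetEset; exact: subI.
- by move=> n; exact: measurable_itv.
- move=> n; apply: measurable_funS ((measurable_EFinP _ _).2 mf) => //.
  by move=> x /I_gt0 x0; rewrite /= in_itv/= x0.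
- by move=> n x /I_gt0/f0; rewrite lee_fin.
Qed.

(** Dominated convergence for the restrictions of [f] to the segments, with dominating function
    [|f|]. This is the form for oscillating integrands. *)
Lemma integrable_FTC_itv0y : mu.-integrable (`]0, +oo[ : set R) (EFin \o f) ->
  (\int[mu]_(x in `]0%R, +oo[) (f x)%:E = (loo - l0)%:E)%E.
Proof.
move=> intf; apply: (cvg_unique _ _ integral_segments) => //=.
have mI n : measurable (I n) by exact: measurable_itv.
have II n : `]0, +oo[ `&` I n = I n.
  by apply/setIidPr => x /I_gt0 x0; rewrite /= in_itv/= x0.
rewrite (_ : (fun n => _) =
    (fun n => \int[mu]_(x in `]0%R, +oo[) ((EFin \o f) \_ (I n)) x)%E); last first.
  by apply/funext => n; rewrite -[in LHS](II n) integral_mkcondr.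
apply: (@dominated_cvg _ _ _ mu _ _ _ _ (fun x => `|(f x)%:E|%E)) => //.
- move=> n; apply/(measurable_restrict _ (mI n)) => //.
  rewrite II; apply: measurable_funS ((measurable_EFinP _ _).2 mf) => //.
  by move=> x /I_gt0 x0; rewrite /= in_itv/= x0.
- move=> x; rewrite -[X in X x]itv0y_bigcup_segments => -[k _ Ikx].
  apply: cvg_near_cst; near=> m; rewrite patchE mem_set//=.
  by apply: (@subI k) => //; near: m; exact: nbhs_infty_ge.
- exact: integrable_abse.
- move=> n x _; rewrite patchE; case: ifPn => // _.
  by rewrite abse0.
Unshelve. all: by end_near. Qed.

End FTC_itv0y.

(** * Bounds, limits and integrability of x^p exp(-m x^a) *)

Section powR_expR.
Context (R : realType).
Implicit Types (a p m x : R).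
Local Notation mu := (@lebesgue_measure R).

(** For [p > 0] put r = p/a and s = (m/r) x^a. Raising s <= 1 + s <= exp(s) to the power r gives
    (m/r)^r x^p <= exp(m x^a), hence the constant C = (m/r)^(-r). *)
Lemma powR_expR_bounded p a m : 0 <= p -> 0 < a -> 0 < m ->
  exists2 C, 0 <= C & forall x, 0 < x -> x `^ p * expR (- (m * x `^ a)) <= C.
Proof.
rewrite le_eqVlt => /predU1P[<-|p0] a0 m0.
  exists 1 => // x x0; rewrite powRr0 mul1r expR_le1 oppr_le0.
  by rewrite mulr_ge0 ?powR_ge0// ltW.
have r0 : 0 < p / a by rewrite divr_gt0.
exists ((m / (p / a)) `^ (p / a))^-1 => [|x x0].
  by rewrite invr_ge0 powR_ge0.
have pE : x `^ p = (x `^ a) `^ (p / a) by rewrite -powRrM mulrCA divff ?gt_eqF// mulr1.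
have t0 : 0 < x `^ a by rewrite powR_gt0.
rewrite pE expRN ler_pdivrMr ?expR_gt0// ler_pdivlMl ?powR_gt0 ?divr_gt0//.
rewrite -powRM ?(ltW t0) ?(ltW (divr_gt0 m0 r0))//.
have -> : m * x `^ a = m / (p / a) * x `^ a * (p / a).
  by rewrite mulrAC divfK ?gt_eqF.
rewrite expRM ge0_ler_powR ?(ltW r0) ?nnegrE ?expR_ge0//.
  by rewrite mulr_ge0 ?divr_ge0 ?ltW.
by rewrite (le_trans _ (expR_ge1Dx _))// lerDr.
Qed.

(** The bound for the exponent [p + 1] leaves a factor 1/x to spare, so the function is squeezed
    between 0 and C/x. *)
Lemma powR_expR_cvgy p a m : 0 <= p -> 0 < a -> 0 < m ->
  x `^ p * expR (- (m * x `^ a)) @[x --> +oo] --> 0.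
Proof.
move=> p0 a0 m0.
have [C C0 Cub] := @powR_expR_bounded (p + 1) a m (addr_ge0 p0 ler01) a0 m0.
apply: (@squeeze_cvgr _ _ _ _ (cst 0) (fun x => C * x^-1)).
- near=> x; have x0 : 0 < x by near: x; exact: nbhs_pinfty_gt.
  rewrite mulr_ge0 ?powR_ge0 ?expR_ge0//= ler_pdivlMr//.
  suff -> : x `^ p * expR (- (m * x `^ a)) * x =
      x `^ (p + 1) * expR (- (m * x `^ a)) by exact: Cub.
  by rewrite mulrAC powRD ?(gt_eqF x0) ?implybT// powRr1// ltW.
- exact: cvg_cst.
- rewrite -[X in _ --> X](mulr0 C); apply: cvgMl_tmp.
  apply/(gtr0_cvgV0 _); last exact: cvg_id.
  exact: nbhs_pinfty_gt.
Unshelve. all: by end_near. Qed.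

Lemma powR_expR_cvg0 p a m : 0 < p -> 0 < m ->
  x `^ p * expR (- (m * x `^ a)) @[x --> 0^'+] --> 0.
Proof.
move=> p0 m0; apply: (@squeeze_cvgr _ _ _ _ (cst 0) (fun x => x `^ p)).
- near=> x; rewrite mulr_ge0 ?powR_ge0 ?expR_ge0//= ler_piMr ?powR_ge0//.
  by rewrite expR_le1 oppr_le0 mulr_ge0 ?powR_ge0// ltW.
- exact: cvg_cst.
- exact: powR_cvg0.
Unshelve. all: by end_near. Qed.

Lemma is_derive_expR_powR a m x : 0 < x ->
  is_derive x 1 (fun y => expR (- (m * y `^ a)))
    (- (m * (a * x `^ (a - 1))) * expR (- (m * x `^ a))).
Proof.
move=> x0; have da := is_derive1_powR a x0.
pose g := fun y => - (m * y `^ a).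
have dg : is_derive x 1 g (- (m * (a * x `^ (a - 1)))).
  by apply: is_deriveN; apply: is_deriveZ.
rewrite mulrC.
exact: (@is_derive1_comp _ expR g).
Qed.

Lemma continuous_powR_gt0 a x : 0 < x -> {for x, continuous (fun y => y `^ a)}.
Proof.
move=> x0; apply/differentiable_continuous/derivable1_diffP.
by have [] := is_derive1_powR a x0.
Qed.

Lemma continuous_powR_expR p a m x : 0 < x ->
  {for x, continuous (fun y => y `^ p * expR (- (m * y `^ a)))}.
Proof.
move=> x0; apply: cvgM; first exact: continuous_powR_gt0.
apply: continuous_comp; last exact: continuous_expR.
apply: cvgN; apply: cvgM; first exact: cvg_cst.
exact: continuous_powR_gt0.
Qed.

Lemma cvg_expR_powR0 a m : 0 < a -> expR (- (m * x `^ a)) @[x --> 0^'+] --> (1 : R).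
Proof.
move=> a0; rewrite -[X in _ --> X]expR0.
apply: continuous_cvg; first exact: continuous_expR.
rewrite -[X in _ --> X]oppr0 -[X in - X](mulr0 m); apply: cvgN.
by apply: cvgMl_tmp; exact: powR_cvg0.
Qed.

Lemma measurable_powR_expR p a m :
  measurable_fun setT (fun x => x `^ p * expR (- (m * x `^ a))).
Proof.
apply: measurable_funM; first exact: measurable_powR.
apply: measurableT_comp => //; apply: measurableT_comp => //.
apply: measurable_funM => //; exact: measurable_powR.
Qed.

(** The exponent [a - 1] is the one with an elementary primitive, -exp(-m x^a)/(m a). It serves as
    the comparison function for the larger exponents. *)
Lemma integrable_expR_powR a m : 0 < a -> 0 < m ->
  mu.-integrable (`]0, +oo[ : set R)
    (EFin \o (fun x => x `^ (a - 1) * expR (- (m * x `^ a)))).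
Proof.
move=> a0 m0; apply/integrableP; split.
  by apply/measurable_EFinP; apply: measurable_funTS; exact: measurable_powR_expR.
under eq_integral do rewrite /= ger0_norm ?mulr_ge0 ?powR_ge0 ?expR_ge0//.
pose F (x : R) : R := - (m * a)^-1 * expR (- (m * x `^ a)).
have dF (x : R) : 0 < x -> is_derive x 1 F (x `^ (a - 1) * expR (- (m * x `^ a))).
  move=> x0; have dx := is_derive_expR_powR a m x0.
  apply: (is_derive_eq (is_deriveZ (- (m * a)^-1) dx)).
  by rewrite /GRing.scale/=; field; rewrite !gt_eqF.
rewrite (ge0_FTC_itv0y dF _ (_ : F x @[x --> 0^'+] --> - (m * a)^-1 * 1)
  (_ : F x @[x --> +oo] --> 0)) ?ltry//.
- by move=> x x0; exact: continuous_powR_expR.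
- by apply: cvgMl_tmp; exact: cvg_expR_powR0.
- rewrite -[X in _ --> X](mulr0 (- (m * a)^-1)); apply: cvgMl_tmp.
  have := powR_expR_cvgy (lexx 0) a0 m0.
  by under eq_fun do rewrite powRr0 mul1r.
- by move=> x x0; rewrite mulr_ge0 ?powR_ge0 ?expR_ge0.
Qed.

(** The exponential is split into two equal halves: one keeps x^(q-a) bounded, the other makes
    x^(a-1) integrable. *)
Lemma integrable_powR_expR q a m : 0 < a -> a <= q -> 0 < m ->
  mu.-integrable (`]0, +oo[ : set R)
    (EFin \o (fun x => x `^ (q - 1) * expR (- (m * x `^ a)))).
Proof.
move=> a0 aq m0; have m20 : 0 < m / 2 by rewrite divr_gt0.
have [|C C0 Cub] := @powR_expR_bounded (q - a) a (m / 2) _ a0 m20.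
  by rewrite subr_ge0.
apply: (le_integrable _ _ _ (integrableZl _ C (integrable_expR_powR a0 m20))) => //.
  by apply/measurable_EFinP; apply: measurable_funTS; exact: measurable_powR_expR.
move=> x; rewrite /= in_itv/= andbT => x0.
rewrite lee_fin !ger0_norm ?mulr_ge0 ?powR_ge0 ?expR_ge0//.
have -> : x `^ (q - 1) * expR (- (m * x `^ a)) =
    x `^ (q - a) * expR (- (m / 2 * x `^ a)) *
    (x `^ (a - 1) * expR (- (m / 2 * x `^ a))).
  rewrite mulrACA -powRD ?(gt_eqF x0) ?implybT// -expRD.
  by congr (_ `^ _ * expR _); field.
by rewrite ler_wpM2r ?mulr_ge0 ?powR_ge0 ?expR_ge0// Cub.
Qed.

Lemma integrable_powR_expR_mul q a m (h : R -> R) : 0 < a -> a <= q -> 0 < m ->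
  measurable_fun (setT : set R) h -> (forall x, `|h x| <= 1) ->
  mu.-integrable (`]0, +oo[ : set R)
    (EFin \o (fun x => x `^ (q - 1) * expR (- (m * x `^ a)) * h x)).
Proof.
move=> a0 aq m0 mh h1.
apply: (le_integrable _ _ _ (integrable_powR_expR a0 aq m0)) => //.
  apply/measurable_EFinP; apply: measurable_funTS.
  by apply: measurable_funM mh; exact: measurable_powR_expR.
move=> x _; rewrite lee_fin normrM ler_piMr//.
Qed.

End powR_expR.

(** * Rotating the angle t does not change the integral *)

Section rotation.
Context (R : realType).
Local Notation mu := (@lebesgue_measure R).
Variables (a c q psi : R).
Hypotheses (a0 : 0 < a) (c0 : 0 < c) (aq : a <= q).

Let phase (t x : R) : R := c * sin t * x `^ a - q / a * t + psi.
Let g (t x : R) : R :=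
  x `^ (q - 1) * expR (- (c * cos t * x `^ a)) * sin (phase t x).
Let dg (t x : R) : R :=
  x `^ (q - 1) * expR (- (c * cos t * x `^ a)) *
  (c * sin t * x `^ a * sin (phase t x) +
   (c * cos t * x `^ a - q / a) * cos (phase t x)).

Let is_derive_g (t x : R) : is_derive t 1 (g ^~ x) (dg t x).
Proof.
pose k : R := x `^ a.
have dE : is_derive t 1 (fun s => expR (- (c * cos s * k)))
    (expR (- (c * cos t * k)) * (c * sin t * k)).
  pose h s := - (c * cos s * k); apply: (@is_derive1_comp _ expR h).
  have -> : h = (- (c * k)) \*: cos by apply/funext => s; rewrite /h/= /GRing.scale/=; ring.
  by apply: is_derive_eq; rewrite /GRing.scale/=; ring.
have dP : is_derive t 1 (phase ^~ x) (c * cos t * k - q / a).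
  have -> : phase ^~ x = (c * k) \*: sin + (- (q / a)) \*: id + cst psi.
    by apply/funext => s; rewrite /phase !fctE/= /GRing.scale/= -/k; ring.
  by apply: is_derive_eq; rewrite /GRing.scale/=; ring.
have dS : is_derive t 1 (fun s => sin (phase s x))
    (cos (phase t x) * (c * cos t * k - q / a)).
  exact: (@is_derive1_comp _ sin (phase ^~ x)).
have -> : g ^~ x = (x `^ (q - 1)) \*: ((fun s => expR (- (c * cos s * k))) *
    (fun s => sin (phase s x))).
  by apply/funext => s; rewrite /g !fctE/= /GRing.scale/= -/k; ring.
by apply: is_derive_eq; rewrite /dg /GRing.scale/= -/k; ring.
Qed.

(** The key identity: the t-derivative of [g] is also an exact x-derivative. This is a real form of
    moving the contour of a Gamma integral along a ray. *)
Let is_derive_primitive (t x : R) : 0 < x ->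
  is_derive x 1 (fun y => - a^-1 * (y `^ q * expR (- (c * cos t * y `^ a)) * cos (phase t y)))
    (dg t x).
Proof.
move=> x0.
have dpa := is_derive1_powR a x0.
have dpq := is_derive1_powR q x0.
have dE := is_derive_expR_powR a (c * cos t) x0.
have dP : is_derive x 1 (phase t) (c * sin t * (a * x `^ (a - 1))).
  have -> : phase t = (c * sin t) \*: (fun y => y `^ a) + cst (psi - q / a * t).
    by apply/funext => s; rewrite /phase !fctE/= /GRing.scale/=; ring.
  by apply: is_derive_eq; rewrite /GRing.scale/=; ring.
have dC : is_derive x 1 (fun y => cos (phase t y))
    (- sin (phase t x) * (c * sin t * (a * x `^ (a - 1)))).
  exact: (@is_derive1_comp _ cos (phase t)).
have -> : (fun y => - a^-1 * (y `^ q * expR (- (c * cos t * y `^ a)) * cos (phase t y))) =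
  (- a^-1) \*: ((fun y => y `^ q) * (fun y => expR (- (c * cos t * y `^ a)))
    * (fun y => cos (phase t y))).
  by apply/funext => s; rewrite !fctE.
(* Both powers are reduced to x^(q-1) and x^(a-1), so that the identity becomes algebraic and
   [field] can check it. *)
have qE : x `^ q = x `^ (q - 1) * x.
  by rewrite mulrC mulr_powRB1 ?ltW// (lt_le_trans a0).
have aE : x `^ a = x `^ (a - 1) * x by rewrite mulrC mulr_powRB1 ?ltW.
apply: is_derive_eq; rewrite /dg /GRing.scale/= !fctE qE; set E := expR _.
rewrite aE; field.
by rewrite gt_eqF.
Qed.

Let continuous_phase (t x : R) : 0 < x -> {for x, continuous (phase t)}.
Proof.
move=> x0; apply: cvgD; last exact: cvg_cst.
apply: cvgD; last exact: cvg_cst.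
by apply: cvgMl_tmp; exact: continuous_powR_gt0.
Qed.

Let measurable_phase t : measurable_fun (setT : set R) (phase t).
Proof.
apply: measurable_funD => //; apply: measurable_funD => //.
by apply: measurable_funM => //; exact: measurable_powR.
Qed.

Let measurable_dg t : measurable_fun (setT : set R) (dg t).
Proof.
have mp := measurable_phase t; have ma := @measurable_powR R a.
have mS := continuous_measurable_fun (@continuous_sin R).
have mC := continuous_measurable_fun (@continuous_cos R).
apply: measurable_funM; first exact: measurable_powR_expR.
apply: measurable_funD; apply: measurable_funM.
- exact: measurable_funM.
- exact: measurableT_comp.
- by apply: measurable_funB => //; exact: measurable_funM.
- exact: measurableT_comp.
Qed.

Let continuous_dg (t x : R) : 0 < x -> {for x, continuous (dg t)}.
Proof.
move=> x0; have cp := @continuous_phase t x x0; have ca := @continuous_powR_gt0 _ a _ x0.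
apply: cvgM; first exact: continuous_powR_expR.
apply: cvgD; apply: cvgM.
- by apply: cvgMl_tmp.
- by apply: continuous_comp cp _; exact: continuous_sin.
- by apply: cvgB; [exact: cvgMl_tmp|exact: cvg_cst].
- by apply: continuous_comp cp _; exact: continuous_cos.
Qed.

Variable u : R.
Hypothesis cosu0 : 0 < cos u.

(** An integrable bound for [dg t] uniform over all t with cos t >= cos u: the exponential decays at
    least at the rate of the angle [u], and the remaining sines and cosines are bounded by 1. The
    coefficient 2c collects one c x^a from the sine term and one from the cosine term. *)
Let G (x : R) : R := 2 * c * (x `^ (q + a - 1) * expR (- (c * cos u * x `^ a))) +
  q / a * (x `^ (q - 1) * expR (- (c * cos u * x `^ a))).

Let cu0 : 0 < c * cos u. Proof. exact: mulr_gt0. Qed.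

Let qa0 : 0 <= q / a.
Proof. by rewrite divr_ge0 ?ltW// (lt_le_trans a0). Qed.

Let G_ge0 x : 0 <= G x.
Proof.
by apply: addr_ge0; apply: mulr_ge0 => //;
  rewrite mulr_ge0 ?powR_ge0 ?expR_ge0 ?(ltW c0).
Qed.

Let integrable_G : mu.-integrable (`]0, +oo[ : set R) (EFin \o G).
Proof.
pose e p (x : R) : R := x `^ (p - 1) * expR (- (c * cos u * x `^ a)).
have -> : EFin \o G = ((fun x => (2 * c)%:E * (EFin \o e (q + a)%R) x) \+
    (fun x => (q / a)%:E * (EFin \o e q) x))%E.
  by apply/funext => x /=; rewrite -!EFinM -EFinD.
apply: integrableD => //; apply: integrableZl => //; apply: integrable_powR_expR => //.
by rewrite lerDr (le_trans _ aq)// ltW.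
Qed.

Let expR_cos_le t x : cos u <= cos t ->
  expR (- (c * cos t * x `^ a)) <= expR (- (c * cos u * x `^ a)).
Proof.
by move=> cosut; rewrite ler_expR lerN2 ler_wpM2r ?powR_ge0// ler_pM2l.
Qed.

Let integrable_g t : cos u <= cos t ->
  mu.-integrable (`]0, +oo[ : set R) (EFin \o g t).
Proof.
move=> cosut; apply: integrable_powR_expR_mul => //.
- by rewrite mulr_gt0// (lt_le_trans cosu0).
- apply: measurableT_comp; last exact: measurable_phase.
  exact: continuous_measurable_fun (@continuous_sin R).
- by move=> x; exact: sin_max.
Qed.

Let dg_ub (t x : R) : cos u <= cos t -> 0 < x -> `|dg t x| <= G x.
Proof.
move=> cosut x0; have -> : G x = x `^ (q - 1) * expR (- (c * cos u * x `^ a)) *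
    (c * x `^ a + (c * x `^ a + q / a)).
  by rewrite /G (addrAC q) (@powRD _ x (q - 1) a) ?(gt_eqF x0) ?implybT//; ring.
rewrite normrM ler_pM//.
  rewrite normrM !ger0_norm ?powR_ge0 ?expR_ge0//.
  by rewrite ler_wpM2l ?powR_ge0 ?expR_cos_le.
have cx0 : 0 <= c * x `^ a by rewrite mulr_ge0 ?powR_ge0// ltW.
rewrite (le_trans (ler_normD _ _))// lerD// normrM.
  rewrite -[leRHS]mulr1 ler_pM ?sin_max// mulrAC normrM (ger0_norm cx0).
  by rewrite ler_piMr ?sin_max.
rewrite -[leRHS]mulr1 ler_pM ?cos_max//.
rewrite (le_trans (ler_normB _ _))// (ger0_norm qa0) lerD2r.
by rewrite mulrAC normrM (ger0_norm cx0) ler_piMr ?cos_max.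
Qed.

Let integrable_dg t : cos u <= cos t ->
  mu.-integrable (`]0, +oo[ : set R) (EFin \o dg t).
Proof.
move=> cosut; apply: (le_integrable _ _ _ integrable_G) => //.
  by apply/measurable_EFinP; apply: measurable_funTS; exact: measurable_dg.
move=> x; rewrite /= in_itv/= andbT => x0.
by rewrite lee_fin (ger0_norm (G_ge0 x)) dg_ub.
Qed.

(** The primitive of [dg t] vanishes at both ends: at 0 because q > 0, at infinity because c cos t >
    0. *)
Let integral_dg t : cos u <= cos t ->
  (\int[mu]_(x in `]0%R, +oo[) (dg t x)%:E = 0)%E.
Proof.
move=> cosut; pose E (y : R) := y `^ q * expR (- (c * cos t * y `^ a)).
have ct0 : 0 < c * cos t by rewrite mulr_gt0// (lt_le_trans cosu0).
have q0 : 0 < q by rewrite (lt_le_trans a0).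
(* The cosine is bounded, so either limit reduces to that of x^q exp(-c x^a cos t). The filter is
   kept abstract to serve both ends. *)
have ecos F : Filter F -> E x @[x --> F] --> 0 ->
    - a^-1 * (E x * cos (phase t x)) @[x --> F] --> 0.
  move=> FF E0; rewrite -[X in _ --> X](mulr0 (- a^-1)); apply: cvgMl_tmp.
  apply: norm_cvg0; apply: (@squeeze_cvgr _ _ _ _ (cst 0) E) => //.
  + near=> x; rewrite normr_ge0/= normrM ger0_norm ?mulr_ge0 ?powR_ge0 ?expR_ge0//.
    by rewrite ler_piMr ?cos_max// mulr_ge0 ?powR_ge0 ?expR_ge0.
  + exact: cvg_cst.
rewrite (@integrable_FTC_itv0y _ _ _ 0 0 (@is_derive_primitive t)) ?subrr//.
- by move=> x; exact: continuous_dg.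
- by apply: ecos; apply: powR_expR_cvg0.
- by apply: ecos; apply: powR_expR_cvgy => //; exact: ltW.
- exact: integrable_dg.
Unshelve. all: by end_near. Qed.

(** Differentiation under the integral sign, dominated by [G]. The open interval []-u, u[] is
    symmetric so that 0 is an interior point; cosine being even and decreasing on [0, pi], every s
    in it satisfies cos u <= cos s. *)
Let is_derive_integral_g (t : R) : `|t| < u -> u < pi -> 
  is_derive t 1 (fun s => \int[mu]_(x in `]0, +oo[) g s x)%R 0.
Proof.
move=> tu upi.
have It : (`]- u, u[%classic : set R) t by rewrite /= in_itv/= -ltr_norml.
have cosI s : (`]- u, u[%classic : set R) s -> cos u <= cos s.
  rewrite /= in_itv/= -ltr_norml => su.
  rewrite -(cos_norm s) ltW// ltr_cos ?in_itv//= ?normr_ge0 ?(ltW (lt_trans su _))//.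
  by rewrite (le_trans (normr_ge0 s) (ltW su)) ltW.
have d1g s x : partial1of2 g s x = dg s x.
  by rewrite partial1of2E; have [_ ->] := is_derive_g s x.
have intg s (Is : (`]- u, u[%classic : set R) s) := integrable_g (cosI s Is).
have derg s x (_ : (`]- u, u[%classic : set R) s) (_ : (`]0, +oo[%classic : set R) x) :
    derivable (g ^~ x) s 1.
  by have [] := is_derive_g s x.
have Gub s x (Is : (`]- u, u[%classic : set R) s)
    (x0 : (`]0, +oo[%classic : set R) x) : `|partial1of2 g s x| <= G x.
  by rewrite d1g dg_ub ?cosI//; move: x0; rewrite /= in_itv/= andbT.
have mP : measurable (`]0%R, +oo[%classic : set R) by exact: measurable_itv.
split; first exact: (@derivable_under_integral R _ (measurableTypeR R) mu
    _ _ mP _ _ _ It intg derg _ G_ge0 integrable_G Gub).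
rewrite -derive1E (@differentiation_under_integral R _ (measurableTypeR R) mu
  _ _ mP _ _ _ It intg derg _ G_ge0 integrable_G Gub).
rewrite /Rintegral (_ : \int[mu]_(x in _) _ = 0)%E//.
rewrite -[RHS](integral_dg (cosI t It)); apply: eq_integral => x _.
by rewrite d1g.
Qed.

(** By the mean value theorem the integral at [t] equals the one at 0, where the phase is the
    constant [psi] and the integrand vanishes identically. *)
Lemma integral_rotation_eq0 (t : R) : 0 <= t < u -> u < pi -> sin psi = 0 ->
  (\int[mu]_(x in `]0%R, +oo[) (x `^ (q - 1) * expR (- (c * cos t * x `^ a)) *
     sin (c * sin t * x `^ a - q / a * t + psi))%:E = 0)%E.
Proof.
move=> /andP[t0 tu] upi psi0.
have su s : s \in `[0, t] -> `|s| < u.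
  by rewrite in_itv/= => /andP[s0 st]; rewrite ger0_norm// (le_lt_trans st).
pose F s := (\int[mu]_(x in `]0, +oo[) g s x)%R.
have F0 : F 0 = 0.
  rewrite /F /Rintegral (_ : \int[mu]_(x in _) _ = 0)%E//.
  apply: integral0_eq => x _.
  by rewrite /g /phase sin0 !(mulr0, mul0r) subr0 add0r psi0 mulr0.
have Ft : F t = 0.
  have [||s _] := @MVT_segment _ F (cst 0) 0 t t0; last first.
    by rewrite F0 subr0 => ->; rewrite mul0r.
    apply: derivable_within_continuous => s /su su'.
    by have [] := is_derive_integral_g su' upi.
  by move=> s /subset_itv_oo_cc/su su'; exact: is_derive_integral_g.
have cost : cos u <= cos t.
  rewrite ltW// ltr_cos ?in_itv//= ?t0 ?(ltW (lt_trans tu _))//.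
  by rewrite (le_trans t0 (ltW tu)) ltW.
(* [F t] is a real value obtained through [fine], which also sends infinities to 0; integrability of
   [g t] is what allows the return to the extended integral. *)
rewrite -(fineK (integrable_fin_num _ (integrable_g cost)))//.
by rewrite -[fine _]/(F t) Ft.
Qed.

End rotation.

(** * Damped sine integrals in the form met in the moments *)

Lemma integrable_powR_expR_sin (R : realType) (a b q t phi : R) :
  0 < a -> 0 < b -> a <= q ->
  (@lebesgue_measure R).-integrable (`]0, +oo[ : set R)
    (EFin \o (fun x => x `^ (q - 1) * expR (- (b * x `^ a)) *
       sin (b * x `^ a * tan t - phi))).
Proof.
move=> a0 b0 aq.
apply: (@integrable_powR_expR_mul _ _ _ _ (fun x => sin _)) => //.
  apply: measurableT_comp; first exact: continuous_measurable_fun (@continuous_sin R).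
  apply: measurable_funB => //; apply: measurable_funM => //.
  by apply: measurable_funM => //; exact: measurable_powR.
by move=> x; exact: sin_max.
Qed.

Lemma integral_powR_expR_sin_eq0 (R : realType) (a b q t phi : R) :
  0 < a -> 0 < b -> a <= q -> 0 <= t < pi / 2 -> sin (q / a * t - phi) = 0 ->
  (\int[lebesgue_measure]_(x in `]0%R, +oo[)
     (x `^ (q - 1) * expR (- (b * x `^ a)) *
      sin (b * x `^ a * tan t - phi))%:E = 0)%E.
Proof.
move=> a0 b0 aq /andP[t0 tpi] st0.
have pi0 : 0 < pi :> R := pi_gt0 R.
have cost : 0 < cos t by apply: cos_gt0_pihalf; rewrite tpi andbT; lra.
(* The midpoint of t and pi/2 leaves room above t while its cosine is still positive. *)
have [u [tu upi cosu]] : exists u : R, [/\ t < u, u < pi & 0 < cos u].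
  exists ((t + pi / 2) / 2); split; [lra|lra|].
  by apply: cos_gt0_pihalf; apply/andP; split; lra.
(* With c = b / cos t one has c cos t = b and c sin t = b tan t; the choice of psi turns the phase
   into b x^a tan t - phi. *)
have := @integral_rotation_eq0 R a (b / cos t) q (q / a * t - phi) a0
  (divr_gt0 b0 cost) aq u cosu t.
rewrite t0 tu => /(_ isT upi st0) <-.
apply: eq_integral => x _; rewrite divfK ?gt_eqF//.
by congr (_ * sin _)%:E; rewrite /tan; ring.
Qed.

(** * Reduction to the positive half-line and normalization of the supremum *)

Section gt0_supported.
Context (R : realType).
Local Notation mu := (@lebesgue_measure R).
Variable f : R -> R.
Hypothesis f_le0 : forall x, x <= 0 -> f x = 0.

Let restrict_itv0y : (EFin \o f) \_ (`]0, +oo[%classic : set R) = EFin \o f.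
Proof.
apply/funext => x; rewrite patchE; case: ifPn => //.
by rewrite notin_setE/= in_itv/= andbT => /negP; rewrite -leNgt => /f_le0 ->.
Qed.

Lemma integral_gt0_supported :
  (\int[mu]_x (f x)%:E = \int[mu]_(x in `]0%R, +oo[) (f x)%:E)%E.
Proof. by rewrite [RHS]integral_mkcond restrict_itv0y. Qed.

Lemma integrable_gt0_supported :
  mu.-integrable (`]0, +oo[ : set R) (EFin \o f) ->
  mu.-integrable setT (EFin \o f).
Proof. by rewrite integrable_mkcond// restrict_itv0y. Qed.

End gt0_supported.

(** The bound makes the supremum finite and the nonzero value makes it positive, so its inverse is a
    suitable [M] by homogeneity. *)
Lemma sup_abs_normalizable (R : realType) (h : R -> R) (C : R) :
  (forall x, `|h x| <= C) -> (exists x, h x != 0) ->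
  exists M, sup_abs (fun x => M * h x) = 1%E.
Proof.
move=> hC [x0 hx0].
have s_le : (sup_abs h <= C%:E)%E.
  by apply/ereal_supP => _ [x _ <-]; rewrite lee_fin.
have s_gt : (0 < sup_abs h)%E.
  rewrite (@lt_le_trans _ _ `|h x0|%:E) ?lte_fin ?normr_gt0//.
  by apply: ereal_sup_ubound; exists x0.
have sE : sup_abs h = (fine (sup_abs h))%:E.
  by rewrite fineK// fin_real// (lt_le_trans _ (ltW s_gt)) ?ltNyr// (le_lt_trans s_le) ?ltry.
have r0 : 0 < fine (sup_abs h) by rewrite -lte_fin -sE.
exists (fine (sup_abs h))^-1; rewrite {1}/sup_abs.
have -> : [set `|(fine (sup_abs h))^-1 * h x|%:E | x in [set: R]] =
    [set ((fine (sup_abs h))^-1%:E * y)%E | y in [set `|h x|%:E | x in [set: R]]].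
  rewrite image_comp; congr (_ @` _); apply/funext => x /=.
  by rewrite normrM gtr0_norm ?invr_gt0// EFinM.
rewrite ereal_sup_pZl ?invr_gt0// -/(sup_abs h) {2}sE -EFinM mulVf// gt_eqF//.
Qed.

Lemma sin_natM_pi (R : realType) n : sin (n%:R * pi) = 0 :> R.
Proof.
elim: n => [|n IHn]; first by rewrite mul0r sin0.
by rewrite -natr1 mulrDl mul1r sinDpi IHn oppr0.
Qed.

(** * The power Lindley density: total mass and moments *)

Section power_lindley.
Context (R : realType).
Local Notation mu := (@lebesgue_measure R).
Variables (a b : R).
Hypotheses (a0 : 0 < a) (b0 : 0 < b).

Let K := a * b ^+ 2 / (b + 1).

Let K0 : 0 < K.
Proof. by rewrite divr_gt0 ?mulr_gt0 ?exprn_gt0 ?addr_gt0. Qed.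

Lemma power_lindley_pdfE x : 0 < x -> power_lindley_pdf a b x =
  a * b ^+ 2 / (b + 1) *
    ((1 + x `^ a) * x `^ (a - 1) * expR (- (b * x `^ a))).
Proof. by move=> x0; rewrite /power_lindley_pdf x0 -!mulrA. Qed.

Lemma power_lindley_pdf_le0 x : x <= 0 -> power_lindley_pdf a b x = 0.
Proof. by rewrite /power_lindley_pdf leNgt => /negbTE ->. Qed.

Lemma power_lindley_pdf_ge0 x : 0 <= power_lindley_pdf a b x.
Proof.
have [/power_lindley_pdf_le0->//|x0] := leP x 0; rewrite power_lindley_pdfE//.
apply: mulr_ge0; first exact: ltW.
by rewrite !mulr_ge0 ?expR_ge0 ?addr_ge0 ?powR_ge0.
Qed.

Lemma power_lindley_finite_moments : finite_moments (power_lindley_pdf a b).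
Proof.
move=> k; apply: integrable_gt0_supported => [x x0|].
  by rewrite power_lindley_pdf_le0// mulr0.
pose e p (x : R) : R := x `^ (p - 1) * expR (- (b * x `^ a)).
have mP : measurable (`]0, +oo[%classic : set R) by exact: measurable_itv.
(* Expanding 1 + x^a splits x^k f(x) into two terms x^(q-1) exp(-b x^a), with q = k + a and q = k +
   2a. *)
apply: (@eq_integrable _ (measurableTypeR R) _ mu _ mP (fun x => K%:E *
    ((EFin \o e (k%:R + a)%R) x + (EFin \o e (k%:R + a + a)%R) x))%E).
  move=> x; rewrite inE/= in_itv/= andbT => x0.
  rewrite -EFinD -EFinM power_lindley_pdfE// -/K /e -(powR_mulrn _ (ltW x0)); congr EFin.
  have xr r s : x `^ (r + s) = x `^ r * x `^ s.
    by rewrite powRD// (gt_eqF x0) implybT.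
  by rewrite -2!addrA addrCA addrA !xr; ring.
apply: integrableZl => //; apply: integrableD => //;
  by apply: integrable_powR_expR => //; rewrite lerDr ?addr_ge0 ?ler0n ?(ltW a0).
Qed.

Lemma integral_power_lindley_pdf : (\int[mu]_x (power_lindley_pdf a b x)%:E = 1)%E.
Proof.
pose E (x : R) : R := expR (- (b * x `^ a)).
(* A primitive of the density, found by integrating x^a x^(a-1) exp(-b x^a) by parts. It goes from
   -1 at 0 to 0 at infinity. *)
pose F (x : R) : R := - E x - b / (b + 1) * (x `^ a * E x).
pose f (x : R) : R := K * ((1 + x `^ a) * (x `^ (a - 1) * E x)).
rewrite (integral_gt0_supported power_lindley_pdf_le0) (_ : (\int[mu]_(x in _) _)%E =
    (\int[mu]_(x in `]0%R, +oo[) (f x)%:E)%E); last first.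
  apply: eq_integral => x; rewrite inE/= in_itv/= andbT => x0.
  by rewrite power_lindley_pdfE// /f -/K !mulrA.
have dF (x : R) : 0 < x -> is_derive x 1 F (f x).
  move=> x0; have dE : is_derive x 1 E _ := is_derive_expR_powR a b x0.
  have dp := is_derive1_powR a x0.
  have -> : F = - E - (b / (b + 1)) \*: ((fun y => y `^ a) * E).
    by apply/funext => y; rewrite !fctE.
  apply: is_derive_eq; rewrite /f /GRing.scale/= /K -/(E x).
  by field; rewrite gt_eqF// addr_gt0.
rewrite (ge0_FTC_itv0y dF _ (_ : F x @[x --> 0^'+] --> - 1 - b / (b + 1) * 0)
  (_ : F x @[x --> +oo] --> - 0 - b / (b + 1) * 0)).
- by congr EFin; ring.
- move=> x x0; apply: cvgMl_tmp; apply: cvgM; last exact: continuous_powR_expR.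
  by apply: cvgD; [exact: cvg_cst|exact: continuous_powR_gt0].
- apply: cvgB; first by apply: cvgN; exact: cvg_expR_powR0.
  by apply: cvgMl_tmp; exact: powR_expR_cvg0.
- apply: cvgB; [apply: cvgN|apply: cvgMl_tmp; apply: powR_expR_cvgy => //; exact: ltW].
  have := powR_expR_cvgy (lexx 0) a0 b0.
  by under eq_fun do rewrite powRr0 mul1r.
- move=> x _; apply: mulr_ge0; first exact: ltW.
  by rewrite !mulr_ge0 ?expR_ge0 ?addr_ge0 ?powR_ge0.
Qed.

End power_lindley.

Lemma exists_powR_eq (R : realType) (g y : R) : g != 0 -> 0 < y ->
  exists2 x, 0 < x & x `^ g = y.
Proof.
move=> g0 y0; exists (y `^ g^-1); first exact: powR_gt0.
by rewrite -powRrM mulVf// powRr1// ltW.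
Qed.

Lemma measurable_powR_inv1D (R : realType) (p : R) :
  measurable_fun (setT : set R) (fun x => (1 + x `^ p)^-1).
Proof.
have -> : (fun x : R => (1 + x `^ p)^-1) = (fun x => (1 + x `^ p) `^ (-1)).
  by apply/funext => x; rewrite powR_inv1// addr_ge0// powR_ge0.
apply: (measurableT_comp (@measurable_powR R (-1))).
by apply: measurable_funD => //; exact: measurable_powR.
Qed.

(** * A criterion for perturbation functions of the power Lindley density *)

Section perturbation.
Context (R : realType).
Local Notation mu := (@lebesgue_measure R).
Variables (a b : R).
Hypotheses (a0 : 0 < a) (b0 : 0 < b).

Let pdf := power_lindley_pdf a b.

Lemma power_lindley_density : density pdf /\ finite_moments pdf.
Proof.
have fm : finite_moments pdf by exact: power_lindley_finite_moments.
split => //; split; [|exact: power_lindley_pdf_ge0|exact: integral_power_lindley_pdf].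
(* Measurability of the density is read off from its moment of order 0. *)
have /integrableP[/measurable_EFinP + _] := fm 0%N.
by apply: eq_measurable_fun => x _; rewrite expr0 mul1r.
Qed.

Lemma integral_proportional_eq0 (C : R) (f g : R -> R) :
  (forall x, x <= 0 -> f x = 0) -> (forall x, 0 < x -> f x = C * g x) ->
  mu.-integrable (`]0, +oo[ : set R) (EFin \o g) ->
  (\int[mu]_(x in `]0%R, +oo[) (g x)%:E = 0)%E ->
  (\int[mu]_x (f x)%:E = 0)%E.
Proof.
move=> f0 fg ig g0; rewrite integral_gt0_supported//.
rewrite (_ : (\int[mu]_(x in _) _)%E =
    (\int[mu]_(x in `]0%R, +oo[) (C%:E * (EFin \o g) x))%E); last first.
  by apply: eq_integral => x; rewrite inE/= in_itv/= andbT => /fg ->; rewrite EFinM.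
by rewrite integralZl// g0 mule0.
Qed.

(** A single envelope x^(q-1) exp(-m x^g) does two jobs: it is bounded because q >= 1, which gives a
    finite supremum, and it is integrable because q >= g. *)
Lemma perturbation_function_normalize (h : R -> R) (C g m q : R) :
  0 < g -> g <= q -> 1 <= q -> 0 < m -> 0 <= C ->
  measurable_fun (setT : set R) h ->
  (forall x, x <= 0 -> h x = 0) ->
  (forall x, 0 < x -> `|h x| <= C * (x `^ (q - 1) * expR (- (m * x `^ g)))) ->
  (exists x, h x != 0) ->
  (forall M k, \int[mu]_x (x ^+ k * (M * h x) * pdf x)%:E = 0)%E ->
  (exists M, sup_abs (fun x => M * h x) = 1%E) /\
  (forall M, sup_abs (fun x => M * h x) = 1%E ->
    perturbation_function pdf (fun x => M * h x)).
Proof.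
move=> g0 gq q1 m0 C0 mh h0 hub hn0 mom; split.
  have [|D D0 Dub] := @powR_expR_bounded _ (q - 1) g m _ g0 m0.
    by rewrite subr_ge0.
  apply: (@sup_abs_normalizable _ _ (C * D)) hn0 => x.
  have [/h0->|x0] := leP x 0; first by rewrite normr0 mulr_ge0.
  by rewrite (le_trans (hub _ x0))// ler_wpM2l// Dub.
move=> M supM; split => //; first exact: power_lindley_density.
apply: integrable_gt0_supported => [x /h0->|]; first by rewrite mulr0.
apply: (le_integrable _ _ _ (integrableZl _ (`|M| * C)
  (integrable_powR_expR g0 gq m0))) => //.
  by apply/measurable_EFinP; apply: measurable_funTS; exact: measurable_funM.
move=> x; rewrite /= in_itv/= andbT => x0; rewrite lee_fin.
rewrite normrM [leRHS]ger0_norm ?mulr_ge0 ?powR_ge0 ?expR_ge0// -mulrA.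
by rewrite ler_wpM2l// hub.
Qed.

End perturbation.

Lemma addr1_powR_gt0 (R : realType) (x p : R) : 0 < 1 + x `^ p.
Proof. by rewrite ltr_pwDl// powR_ge0. Qed.

Lemma piM_itv (R : realType) (t : R) : 0 < t -> t < 1 / 2 -> 0 < pi * t < pi / 2.
Proof.
move=> t0 t1; have pi0 : 0 < pi :> R := pi_gt0 R.
by rewrite mulr_gt0//= ltr_pM2l// -div1r.
Qed.

Lemma tan_gt0 (R : realType) (t : R) : 0 < t < pi / 2 -> 0 < tan t.
Proof.
move=> /andP[t0 tpi]; have pi0 : 0 < pi :> R := pi_gt0 R.
by rewrite divr_gt0 ?sin_gt0_pihalf ?cos_gt0_pihalf ?t0 ?tpi ?andbT//; lra.
Qed.

Lemma H1_H2 (R : realType) (a b M : R) : H1 a b M = H2 a b (2 * b) a M.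
Proof.
apply/funext => x; rewrite /H1 /H2; case: ifPn => // _.
by congr (_ * expR _ * _); ring.
Qed.

(** * The function [H2], with [g = a] allowed so as to include [H1] *)

Section H2.
Context (R : realType).
Local Notation mu := (@lebesgue_measure R).
Variables (a b c g : R).
Hypotheses (a0 : 0 < a) (b0 : 0 < b) (c0 : 0 < c) (ag : a <= g) (g1 : g < 1 / 2).

Let g0 : 0 < g. Proof. exact: lt_le_trans ag. Qed.

Let angle : 0 < pi * g < pi / 2. Proof. exact: piM_itv. Qed.

Let H2E M : H2 a b c g M = (fun x => M * H2 a b c g 1 x).
Proof. by apply/funext => x; rewrite /H2; case: ifPn => _; ring. Qed.

Let measurable_H2 M : measurable_fun (setT : set R) (H2 a b c g M).
Proof.
apply: measurable_fun_ifT => //; first exact: measurable_fun_ler.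
have mp p := @measurable_powR R p.
apply: measurable_funM.
  apply: measurable_funM.
    apply: measurable_funM => //; apply: measurable_funM => //.
    exact: measurable_powR_inv1D.
  apply: measurableT_comp => //.
  by apply: measurable_funB; exact: measurable_funM.
apply: measurableT_comp; first exact: continuous_measurable_fun (@continuous_sin R).
by apply: measurable_funM => //; exact: measurable_funM.
Qed.

(** At the boundary point 0 the factor x^(1-a) vanishes, since its exponent is nonzero. *)
Let H2_le0 M x : x <= 0 -> H2 a b c g M x = 0.
Proof.
have a1 : 1 - a != 0 by rewrite gt_eqF//; move: ag g1; lra.
rewrite le_eqVlt => /predU1P[->|x0]; last by rewrite /H2 leNgt x0.
by rewrite /H2 lexx powR0// !(mulr0, mul0r).
Qed.

Let H2_neq0 : exists x, H2 a b c g 1 x != 0.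
Proof.
have ct0 : 0 < c * tan (pi * g) by rewrite mulr_gt0// tan_gt0.
have pi0 : 0 < pi :> R := pi_gt0 R.
(* The point is chosen so that the argument of the sine is pi/2. *)
have [x x0 xE] := @exists_powR_eq R g ((pi / 2) / (c * tan (pi * g)))
  (lt0r_neq0 g0) (divr_gt0 (divr_gt0 pi0 (ltr0Sn _ _)) ct0).
exists x; rewrite /H2 ltW//.
have -> : c * x `^ g * tan (pi * g) = pi / 2.
  by rewrite mulrAC xE mulrCA divff ?mulr1// gt_eqF.
rewrite sin_pihalf mulr1 mul1r !mulf_neq0 ?invr_eq0//.
- by rewrite gt_eqF// powR_gt0.
- by rewrite gt_eqF ?addr1_powR_gt0.
- by rewrite gt_eqF// expR_gt0.
Qed.

(** The factors x^(1-a), 1/(1 + x^a) and exp(b x^a) of [H2] cancel against the density, leaving q =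
    k + 1 and phi = 0. With t = pi g the condition reads sin((k + 1) pi) = 0. *)
Let H2_moment M k :
  (\int[mu]_x (x ^+ k * (M * H2 a b c g 1 x) * power_lindley_pdf a b x)%:E = 0)%E.
Proof.
have gk : g <= k.+1%:R.
  by rewrite -natr1; have := ler0n R k; move: g1; lra.
apply: (integral_proportional_eq0 (C := M * (a * b ^+ 2 / (b + 1)))
  (g := fun x => x `^ (k.+1%:R - 1) * expR (- (c * x `^ g)) *
    sin (c * x `^ g * tan (pi * g) - 0))).
- by move=> x x0; rewrite power_lindley_pdf_le0// mulr0.
- move=> x x0; rewrite power_lindley_pdfE// /H2 ltW// subr0 mul1r.
  have -> : k.+1%:R - 1 = k%:R :> R by rewrite -natr1 addrK.
  rewrite powR_mulrn ?ltW// expRD !expRN.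
  have -> : x `^ (a - 1) = (x `^ (1 - a))^-1 by rewrite -powRN opprB.
  by field; rewrite !gt_eqF ?expR_gt0 ?powR_gt0 ?addr1_powR_gt0 ?addr_gt0.
- exact: integrable_powR_expR_sin.
- apply: integral_powR_expR_sin_eq0 => //.
  + by case/andP: angle => /ltW -> ->.
  + rewrite subr0 (_ : _ * _ = k.+1%:R * pi) ?sin_natM_pi//.
    by field; rewrite gt_eqF.
Qed.

Variables (m D : R).
Hypothesis m0 : 0 < m.
Hypothesis exponent_le : forall x, 0 < x ->
  b * x `^ a - c * x `^ g <= D - m * x `^ g.

(** The sine and 1/(1 + x^a) are at most 1 in absolute value, and [exponent_le] controls the
    exponential. The exponent 1 - a is written 2 - a - 1 to match the envelope with q = 2 - a. *)
Let H2_envelope x : 0 < x ->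
  `|H2 a b c g 1 x| <= expR D * (x `^ (2 - a - 1) * expR (- (m * x `^ g))).
Proof.
move=> x0; rewrite /H2 (ltW x0) mul1r normrM -[leRHS]mulr1 ler_pM ?sin_max//.
rewrite normrM (ger0_norm (expR_ge0 _)) mulrCA -expRD.
rewrite ler_pM ?expR_ge0 ?ler_expR ?exponent_le//.
rewrite ger0_norm ?divr_ge0 ?powR_ge0 ?(ltW (addr1_powR_gt0 _ _))//.
have -> : 2 - a - 1 = 1 - a by ring.
rewrite ler_pdivrMr ?addr1_powR_gt0//.
by rewrite ler_peMr ?powR_ge0// lerDl powR_ge0.
Qed.

Lemma H2_perturbation :
  (exists M, sup_abs (H2 a b c g M) = 1%E) /\
  (forall M, sup_abs (H2 a b c g M) = 1%E ->
    perturbation_function (power_lindley_pdf a b) (H2 a b c g M)).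
Proof.
have [||[M supM] pert] := perturbation_function_normalize a0 b0 g0 _ _ m0 (expR_ge0 D)
  (measurable_H2 1) (H2_le0 1) H2_envelope H2_neq0 H2_moment.
- by move: ag g1; lra.
- by move: ag g1; lra.
split; first by exists M; rewrite H2E.
by move=> N; rewrite H2E => /pert.
Qed.

End H2.

(** * The function [H3], bounded but not decaying *)

Section H3.
Context (R : realType).
Local Notation mu := (@lebesgue_measure R).
Variables (a b : R).
Hypotheses (a0 : 0 < a) (a1 : a < 1 / 2) (b0 : 0 < b).

Let angle : 0 < pi * a < pi / 2. Proof. exact: piM_itv. Qed.

Let H3E M : H3 a b M = (fun x => M * H3 a b 1 x).
Proof. by apply/funext => x; rewrite /H3; case: ifPn => _; ring. Qed.

Let measurable_H3 M : measurable_fun (setT : set R) (H3 a b M).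
Proof.
apply: measurable_fun_ifT => //; first exact: measurable_fun_ler.
have mp := @measurable_powR R a.
have ms (f : R -> R) : measurable_fun setT f -> measurable_fun setT (sin \o f).
  by apply: measurableT_comp; exact: continuous_measurable_fun (@continuous_sin R).
have mt : measurable_fun (setT : set R) (fun x => b * x `^ a * tan (pi * a)).
  by apply: measurable_funM => //; exact: measurable_funM.
apply: measurable_funM => //.
apply: measurable_funM; last exact: measurable_powR_inv1D.
apply: measurable_funD; first by apply: ms; exact: measurable_funB.
by apply: measurable_funM => //; apply: ms; exact: measurable_funB.
Qed.

(** For x >= 0 the value is an average of two sines with weights 1/(1 + x^a) and x^a/(1 + x^a). *)
Let H3_bounded x : `|H3 a b 1 x| <= 1.
Proof.
rewrite /H3; case: ifPn => // _; last by rewrite normr0.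
rewrite mul1r normrM normfV (gtr0_norm (addr1_powR_gt0 x a)) ler_pdivrMr ?addr1_powR_gt0// mul1r.
rewrite (le_trans (ler_normD _ _))// lerD ?sin_max//.
by rewrite normrM ger0_norm ?powR_ge0// ler_piMr ?powR_ge0 ?sin_max.
Qed.

Let H3_neq0 : exists x, H3 a b 1 x != 0.
Proof.
(* At 0 only the first sine survives, with value -sin(pi a), nonzero because 0 < pi a < pi/2. *)
exists 0; rewrite /H3 lexx powR0 ?(lt0r_neq0 a0)//.
rewrite mulr0 !mul0r !sub0r !addr0 divr1 mul1r sinN oppr_eq0 gt_eqF//.
exact: sin_gt0_pihalf.
Qed.

(** After cancelling 1 + x^a, two damped sine integrals remain: q = k + a with phi = pi a, and q = k
    + 2a with phi = 2 pi a. For t = pi a both have q t/a - phi = k pi. *)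
Let H3_moment M k :
  (\int[mu]_x (x ^+ k * H3 a b M x * power_lindley_pdf a b x)%:E = 0)%E.
Proof.
pose e q phi (x : R) : R := x `^ (q - 1) * expR (- (b * x `^ a)) *
  sin (b * x `^ a * tan (pi * a) - phi).
have ak1 : a <= k%:R + a by rewrite lerDr.
have ak2 : a <= k%:R + 2 * a by rewrite (le_trans ak1)// lerD2l; move: a0; lra.
pose e1 := e (k%:R + a) (pi * a); pose e2 := e (k%:R + 2 * a) (2 * pi * a).
have i1 : mu.-integrable (`]0, +oo[ : set R) (EFin \o e1).
  exact: integrable_powR_expR_sin.
have i2 : mu.-integrable (`]0, +oo[ : set R) (EFin \o e2).
  exact: integrable_powR_expR_sin.
apply: (integral_proportional_eq0 (C := M * (a * b ^+ 2 / (b + 1)))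
  (g := fun x => e1 x + e2 x)).
- by move=> x x0; rewrite power_lindley_pdf_le0// mulr0.
- move=> x x0; rewrite power_lindley_pdfE// /H3 (ltW x0) /e1 /e2 /e.
  have xr r s : x `^ (r + s) = x `^ r * x `^ s.
    by rewrite powRD// (gt_eqF x0) implybT.
  have -> : k%:R + 2 * a - 1 = k%:R + a + (a - 1) by ring.
  rewrite -[k%:R + a - 1]addrA !xr powR_mulrn ?(ltW x0)//.
  by field; rewrite !gt_eqF ?addr1_powR_gt0 ?addr_gt0.
- rewrite (_ : EFin \o _ = ((EFin \o e1) \+ (EFin \o e2))%E); last by apply/funext.
  exact: integrableD.
- under eq_integral do rewrite EFinD.
  rewrite (integralD _ i1 i2)//.
  case/andP: angle => /ltW t0 tpi.
  rewrite !integral_powR_expR_sin_eq0 ?adde0 ?t0 ?tpi//.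
  + rewrite (_ : _ - _ = k%:R * pi) ?sin_natM_pi//.
    by field; rewrite gt_eqF.
  + rewrite (_ : _ - _ = k%:R * pi) ?sin_natM_pi//.
    by field; rewrite gt_eqF.
Qed.

Lemma H3_perturbation :
  (exists M, sup_abs (H3 a b M) = 1%E) /\
  (forall M, sup_abs (H3 a b M) = 1%E ->
    perturbation_function_loc (power_lindley_pdf a b) (H3 a b M)).
Proof.
split.
  have [M supM] := sup_abs_normalizable H3_bounded H3_neq0.
  by exists M; rewrite H3E.
move=> M supM; split=> //; first exact: power_lindley_density.
split=> //; first exact: openT.
(* Local integrability: a bounded measurable function is integrable on a compact set, which has
   finite measure. *)
move=> K _ cK; have mK := compact_measurable cK.
have muK := compact_finite_measure cK.
suff /integrableP[] : mu.-integrable K (EFin \o H3 a b M) by [].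
apply: measurable_bounded_integrable => //.
  by apply: measurable_funTS; exact: measurable_H3.
exists `|M|; split; first exact: num_real.
move=> r Mr x Kx; rewrite /= H3E normrM (le_trans _ (ltW Mr))//.
by rewrite ler_piMr.
Qed.

End H3.

Theorem theorem2p5 (R : realType) (alpha beta : R)
    (halpha0 : 0 < alpha) (halpha1 : alpha < 1 / 2) (hbeta : 0 < beta) :
  [/\ (exists M1 : R, sup_abs (H1 alpha beta M1) = 1%E) /\
      (forall M1 : R, sup_abs (H1 alpha beta M1) = 1%E ->
         perturbation_function (power_lindley_pdf alpha beta)
           (H1 alpha beta M1)),
      forall b gamma : R, 0 < b -> alpha < gamma -> gamma < 1 / 2 ->
        (exists M2 : R, sup_abs (H2 alpha beta b gamma M2) = 1%E) /\
        (forall M2 : R, sup_abs (H2 alpha beta b gamma M2) = 1%E ->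
           perturbation_function (power_lindley_pdf alpha beta)
             (H2 alpha beta b gamma M2)) &
      (exists M3 : R, sup_abs (H3 alpha beta M3) = 1%E) /\
      (forall M3 : R, sup_abs (H3 alpha beta M3) = 1%E ->
         perturbation_function_loc (power_lindley_pdf alpha beta)
           (H3 alpha beta M3))].
Proof.
split; last exact: H3_perturbation.
- have -> : H1 alpha beta = H2 alpha beta (2 * beta) alpha.
    by apply/funext => M; exact: H1_H2.
  (* For b = 2 beta and gamma = alpha the exponent is exactly -beta x^alpha, so m = beta and D = 0
     give equality. *)
  apply: (@H2_perturbation _ _ _ _ _ _ _ _ _ _ beta 0) => //.
    by rewrite mulr_gt0.
  by move=> x _; rewrite le_eqVlt; apply/orP; left; apply/eqP; ring.
- move=> b gamma b0 ag g1.
  (* The positive solution of beta x^alpha = (b/2) x^gamma. Up to [x0] the term beta x^alpha is at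
     most D = beta x0^alpha; beyond it, half of b x^gamma absorbs that term. Hence m = b/2. *)
  pose x0 := (2 * beta / b) `^ (gamma - alpha)^-1.
  apply: (@H2_perturbation _ _ _ _ _ _ _ _ _ _ (b / 2) (beta * x0 `^ alpha)) => //.
  + exact: ltW.
  + by rewrite divr_gt0.
  move=> x xgt0.
  have B0 : 0 < 2 * beta / b by rewrite divr_gt0// mulr_gt0.
  have [xx0|x0x] := leP x x0.
    have : x `^ alpha <= x0 `^ alpha.
      by rewrite ge0_ler_powR ?nnegrE ?powR_ge0// ltW.
    rewrite -(ler_pM2l hbeta) => xle; rewrite lerD// lerN2.
    by rewrite ler_wpM2r ?powR_ge0//; move: b0; lra.
  have Bx : 2 * beta / b <= x `^ (gamma - alpha).
    have -> : 2 * beta / b = x0 `^ (gamma - alpha).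
      by rewrite -powRrM mulVf ?powRr1 ?(ltW B0)// gt_eqF// subr_gt0.
    by rewrite ge0_ler_powR ?nnegrE ?powR_ge0 ?(ltW xgt0) ?(ltW x0x)// subr_ge0 ltW.
  have xE : x `^ gamma = x `^ (gamma - alpha) * x `^ alpha.
    by rewrite -powRD ?subrK// (gt_eqF xgt0) implybT.
  have : beta * x `^ alpha <= b / 2 * x `^ gamma.
    rewrite xE mulrA ler_wpM2r ?powR_ge0//.
    by move: Bx; rewrite ler_pdivrMr//; lra.
  have : 0 <= beta * x0 `^ alpha by rewrite mulr_ge0 ?powR_ge0 ?ltW.
  lra.
Qed.
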